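(* The exponential map $\exp:\mathfrak{u}_{p,q}\to U(p,q)$ is surjective.
   Context: Let $p,q$ be non-negative integers with $n=p+q\geq 1$ and $I_{p,q}=\begin{pmatrix} I_p & 0\\ 0& -I_q\end{pmatrix}$. Then $U(p,q)=\{\mathcal{A}\in GL(n,\mathbb{C}) : \mathcal{A}^*I_{p,q}\mathcal{A}=I_{p,q}\}$, with $^*$ the conjugate transpose, and $\mathfrak{u}_{p,q}=\{X\in M_n(\mathbb{C}): X^*I_{p,q}+I_{p,q}X=0\}$ is its Lie algebra. The exponential map is the matrix exponential. *)

(* Defs.v *)
From mathcomp Require Import all_boot all_order all_algebra.
From mathcomp Require Import all_classical all_reals all_analysis.
From mathcomp Require Import complex.

Set Implicit Arguments.
Unset Strict Implicit.
Unset Printing Implicit Defensive.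

Import Order.TTheory GRing.Theory Num.Theory.
Import numFieldNormedType.Exports.

Local Open Scope classical_set_scope.
Local Open Scope ring_scope.
Local Open Scope sesquilinear_scope.

(* MathComp-Analysis attaches the norm topology of a field, and hence that of
   its matrices, to the projections of the numeric structures and not to the
   bare carrier R[i]; this alias makes it available for complex matrices. *)
Definition Cplx (R : realType) : numClosedFieldType := R[i].

Definition Ipq (R : realType) (p q : nat) : 'M[Cplx R]_(p + q) :=
  block_mx 1%:M 0 0 (- 1%:M).

Definition Upq (R : realType) (p q : nat) : set 'M[Cplx R]_(p + q) :=
  [set A | A \in unitmx /\ A ^t* *m Ipq R p q *m A = Ipq R p q].

Definition upq (R : realType) (p q : nat) : set 'M[Cplx R]_(p + q) :=
  [set X | X ^t* *m Ipq R p q + Ipq R p q *m X = 0].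

Definition expm (R : realType) (n : nat) (X : 'M[Cplx R]_n) : 'M[Cplx R]_n :=
  limn (series (fun k : nat => k`!%:R^-1 *: X ^+ k)).

Arguments Upq : clear implicits.
Arguments upq : clear implicits.
Arguments expm : clear implicits.

(* Main.v *)
From HB Require Import structures.
Require Import Defs.
From mathcomp Require Import all_boot all_order all_algebra.
From mathcomp Require Import all_classical all_reals all_analysis.
From mathcomp Require Import complex.
From mathcomp Require Import ring.

Set Implicit Arguments.
Unset Strict Implicit.
Unset Printing Implicit Defensive.

Import Order.TTheory GRing.Theory Num.Theory.
Import numFieldNormedType.Exports.

Local Open Scope classical_set_scope.
Local Open Scope ring_scope.
Local Open Scope sesquilinear_scope.

(** Let J be the matrix of the form and X |-> J^-1 X^* J its adjoint (formadj
    below), a conjugate-linear anti-automorphism of the matrix algebra that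
    commutes with exp. Then A preserves the form iff adj(A) A = 1, and X is in
    the Lie algebra iff adj(X) = -X. Since adj(exp X) exp X = exp(adj X) exp X,
    exp sends the Lie algebra to the group. The argument is carried out for an
    arbitrary invertible J.

    For surjectivity, choose the logarithm of A compatibly with the symmetry
    a |-> 1/conj(a) that the relation adj(A) = A^-1 imposes on spectra. There
    is a branch Log of the complex logarithm with
    Log(1/conj a) = - conj(Log a): only the modulus is inverted, and the
    argument depends on a/|a| alone ([complex_log]). Let the polynomial P
    interpolate Log at the eigenvalues a of A and at the points 1/conj(a).
    The matrix exp(-P(A)) A is unipotent, hence the exponential of a nilpotent
    Z ([unipotent_log]), and X = P(A) + Z satisfies exp X = A
    ([log_of_branch]).

    It remains to see that D = adj(X) + X vanishes. All the matrices involved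
    commute with one another, so that exp D = adj(A) A = 1. Moreover D is the
    sum of the nilpotents adj(Z) and Z and of adj(P(A)) + P(A), which on an
    eigenvector of A with eigenvalue a acts as
    conj(P(1/conj a)) + P(a) = conj(Log(1/conj a)) + Log a = 0, so D is
    nilpotent. A nilpotent matrix with exponential 1 is zero
    ([nilpotent_expm_eq1]).

    Nilpotency is read off common eigenvectors
    ([nilpotent_common_eigenvector]), and membership in the algebra of
    polynomials in A is replaced by membership in the bicommutant of A, which
    is visibly stable under exp. *)

(** * Partial sums of the exponential series *)

Definition exp_sum (K : numFieldType) (A : algType K) (x : A) (N : nat) : A :=
  \sum_(0 <= k < N) k`!%:R^-1 *: x ^+ k.

(** The defect of multiplicativity is kept explicit: over R it tends to 0
    because the real exponential is multiplicative, and the same double sum,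
    with norms in place of the matrices, bounds the defect for matrices. *)
Lemma exp_sum_mul (K : numFieldType) (A : algType K) (x y : A) N : GRing.comm x y ->
  exp_sum x N * exp_sum y N = exp_sum (x + y) N +
   \sum_(0 <= j < N) \sum_(0 <= i < N | (N <= i + j)%N)
     (i`!%:R^-1 * j`!%:R^-1) *: (x ^+ i * y ^+ j).
Proof.
move=> cxy; pose F i j := (i`!%:R^-1 * j`!%:R^-1) *: (x ^+ i * y ^+ j).
have -> : exp_sum x N * exp_sum y N = \sum_(0 <= j < N) \sum_(0 <= i < N) F i j.
  rewrite exchange_big /exp_sum mulr_suml; apply: eq_bigr => i _.
  rewrite mulr_sumr; apply: eq_bigr => j _.
  by rewrite -scalerAl -scalerAr scalerA.
have -> : exp_sum (x + y) N =
    \sum_(0 <= j < N) \sum_(0 <= i < N | ~~ (N <= i + j)%N) F i j.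
  (* The binomial formula groups the terms by their total degree k. *)
  transitivity (\sum_(0 <= k < N) \sum_(0 <= j < N | (j <= k)%N) F (k - j)%N j).
    rewrite /exp_sum; apply: eq_big_nat => k /andP[_ kN].
    rewrite exprDn_comm // scaler_sumr.
    rewrite -(big_mkord xpredT
      (fun i => k`!%:R^-1 *: (x ^+ (k - i) * y ^+ i *+ 'C(k, i)))).
    rewrite (big_nat_widen 0 k.+1 N) //=; apply: eq_bigr => j.
    rewrite ltnS => jk; rewrite /F -[_ *+ 'C(_,_)]scaler_nat scalerA; congr (_ *: _).
    have f0 m : (m`!%:R : K) != 0 by rewrite pnatr_eq0 -lt0n fact_gt0.
    have c0 : ('C(k, j)%:R : K) != 0 by rewrite pnatr_eq0 -lt0n bin_gt0.
    by rewrite -(bin_fact jk) !natrM; field; rewrite c0 !f0.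
  rewrite (exchange_big_dep_nat xpredT) //=; apply: eq_big_nat => j /andP[_ jN].
  transitivity (\sum_(j <= k < N) F (k - j)%N j).
    by rewrite (big_nat_widenl j 0 N) //=.
  rewrite -{1}(add0n j) big_addn (big_nat_widen 0 (N - j) N) ?leq_subr //=.
  apply: eq_big => [i|i _]; last by rewrite addnK.
  by rewrite ltn_subRL -ltnNge addnC.
rewrite -big_split; apply: eq_bigr => j _ /=.
by rewrite (bigID (fun i => N <= i + j)%N) addrC.
Qed.

Lemma eigen_exprX (K : numFieldType) n p (v : 'M[K]_(p, n.+1))
    (X : 'M[K]_n.+1) (mu : K) k :
  v *m X = mu *: v -> v *m X ^+ k = mu ^+ k *: v.
Proof.
move=> vX; elim: k => [|k IH]; first by rewrite mulmx1 scale1r.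
by rewrite exprSr mulmxA IH -scalemxAl vX scalerA exprSr.
Qed.

Lemma eigen_exp_sum (K : numFieldType) n p (v : 'M[K]_(p, n.+1))
    (X : 'M[K]_n.+1) (mu : K) N :
  v *m X = mu *: v -> v *m exp_sum X N = v *m exp_sum (mu%:M : 'M[K]_n.+1) N.
Proof.
move=> vX; rewrite !mulmx_sumr; apply: eq_bigr => k _.
rewrite -!scalemxAr; congr (_ *: _).
by rewrite !(@eigen_exprX _ _ _ _ _ mu) // mul_mx_scalar.
Qed.

(** * Convergence of complex numbers and matrices *)

(** The embedding of R with codomain [Cplx R], whose topology is the one used
    for complex matrices. *)
Definition toC (R : realType) (r : R) : Cplx R := (r%:C)%C.
HB.instance Definition _ (R : realType) :=
  GRing.RMorphism.copy (@toC R) (real_complex R).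

Section Cvg.
Variable R : realType.
Local Notation C := (Cplx R).

Lemma toC_norm (r : R) : `|toC r| = toC `|r|.
Proof. by rewrite normc_def /= expr0n addr0 sqrtr_sqr. Qed.

Lemma ge0_toC (z : C) : 0 <= z -> exists2 r : R, 0 <= r & z = toC r.
Proof.
move=> z0; have /complex_realP[r zr] : z \is Num.real by rewrite ger0_real.
by exists r => //; rewrite zr ler0c in z0.
Qed.

Lemma cvg_toC (u : R^nat) (l : R) :
  u @ \oo --> l -> (toC (u n) @[n --> \oo] --> toC l).
Proof.
move=> ul; apply/cvgrPdist_lt => e e0.
have [r _ er] := ge0_toC (ltW e0).
have r0 : 0 < r by rewrite er ltcR in e0.
near=> n.
rewrite -rmorphB /= er toC_norm ltcR.
by near: n; move/cvgrPdist_lt : ul; apply.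
Unshelve. all: by end_near. Qed.

Lemma cvg_conj (u : nat -> C) (l : C) :
  u @ \oo --> l -> (u n)^* @[n --> \oo] --> l^*.
Proof.
move=> /cvgrPdist_lt ul; apply/cvgrPdist_lt => e e0.
near=> n; rewrite -rmorphB norm_conjC; near: n; exact: ul.
Unshelve. all: by end_near. Qed.

Lemma cvg_mx m n (u : nat -> 'M[C]_(m, n)) (l : 'M[C]_(m, n)) :
  (forall i j, u k i j @[k --> \oo] --> l i j) -> u @ \oo --> l.
Proof.
move=> ul; apply/cvg_ballP => e e0.
have: \forall k \near \oo, forall ij, ball (l ij.1 ij.2) e (u k ij.1 ij.2).
  apply: filter_forall => -[i j] /=.
  by have /cvg_ballP := ul i j; apply.
by apply: filterS => k H; split=> // i j; exact: (H (i, j)).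
Qed.

Lemma cvg_coord m n (u : nat -> 'M[C]_(m, n)) (l : 'M[C]_(m, n)) i j :
  u @ \oo --> l -> u k i j @[k --> \oo] --> l i j.
Proof.
move=> ul.
by have := @cvg_comp _ _ _ u (fun M => M i j) _ _ _ ul
             (@coord_continuous C m n i j l).
Qed.

Lemma cvg_sumC (I : Type) (r : seq I) (f : I -> nat -> C) (l : I -> C) :
  (forall i, f i n @[n --> \oo] --> l i) ->
  \sum_(i <- r) f i n @[n --> \oo] --> \sum_(i <- r) l i.
Proof.
move=> fl; elim: r => [|i r IH].
  by rewrite big_nil; under eq_fun do rewrite big_nil; exact: cvg_cst.
by rewrite big_cons; under eq_fun do rewrite big_cons; exact: (cvgD (fl i) IH).
Qed.

Lemma cvg_mulmx m n p (u : nat -> 'M[C]_(m, n)) (v : nat -> 'M[C]_(n, p))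
    (a : 'M[C]_(m, n)) (b : 'M[C]_(n, p)) :
  u @ \oo --> a -> v @ \oo --> b -> u k *m v k @[k --> \oo] --> a *m b.
Proof.
move=> ua vb; apply: cvg_mx => i j; rewrite mxE; under eq_fun do rewrite mxE.
apply: (@cvg_sumC _ _ (fun k t => u t i k * v t k j)) => k.
by apply: cvgM; exact: cvg_coord.
Qed.

Lemma cvg_adjoint m n (u : nat -> 'M[C]_(m, n)) (a : 'M[C]_(m, n)) :
  u @ \oo --> a -> (u k)^t* @[k --> \oo] --> a^t*.
Proof.
move=> ua; apply: cvg_mx => i j; rewrite !mxE; under eq_fun do rewrite !mxE.
by apply: (@cvg_conj (fun k => u k j i)); exact: cvg_coord.
Qed.

Lemma cvg_dominated0 (u : nat -> C) (v : R^nat) :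
  (forall k, `|u k| <= toC (v k)) -> v @ \oo --> 0 -> u @ \oo --> 0.
Proof.
move=> uv /cvg_toC/cvgrPdist_lt v0; apply/cvgrPdist_lt => e e0.
near=> n; rewrite sub0r normrN; apply: (le_lt_trans (uv n)).
have : `|toC 0 - toC (v n)| < e by near: n; exact: v0.
by rewrite rmorph0 sub0r normrN ger0_norm // (le_trans _ (uv n)).
Unshelve. all: by end_near. Qed.

(** The real and imaginary parts of the series converge absolutely in R, which
    is complete. *)
Lemma cvg_series_dominated (u : nat -> C) (v : R^nat) :
  (forall k, `|u k| <= toC (v k)) -> cvgn (series v) -> cvgn (series u).
Proof.
move=> uv cv.
have v0 k : 0 <= v k by rewrite -lecR; exact: (le_trans (normr_ge0 (u k)) (uv k)).
have part (f : C -> R) : {morph f : x y / x + y} -> f 0 = 0 ->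
    (forall z, toC `|f z| <= `|z|) -> exists l : R, f (series u n) @[n --> \oo] --> l.
  move=> fD f0 fle; exists (limn (series (f \o u))).
  have -> : (fun n => f (series u n)) = series (f \o u).
    by apply/funext => n; rewrite /series /= (big_morph f fD f0).
  apply: normed_cvg; apply: (series_le_cvg _ v0 _ cv) => k; first exact: normr_ge0.
  by rewrite -lecR; exact: (le_trans (fle (u k)) (uv k)).
have [|||a ua] := part (@complex.Re R) => //.
- by move=> [? ?] [].
- by move=> z; exact: normc_ge_Re.
have [|||b ub] := part (@complex.Im R) => //.
- by move=> [? ?] [].
- by move=> [x y]; rewrite normc_def lecR -sqrtr_sqr ler_wsqrtr //= lerDr sqr_ge0.
apply/cvg_ex; exists (toC a + 'i%C * toC b).
rewrite (_ : series u = (fun n => toC (complex.Re (series u n)) +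
                               'i%C * toC (complex.Im (series u n)))); last first.
  by apply/funext => n; rewrite [LHS]complexE.
by apply: cvgD; [|apply: cvgMr]; exact: cvg_toC.
Qed.
End Cvg.

(** * The matrix exponential *)

Section Norm.
Variables (K : numDomainType).

(** Unlike the maximum norm that defines the topology of matrices, this norm
    is submultiplicative. *)
Definition sumnorm m n (M : 'M[K]_(m, n)) : K := \sum_i \sum_j `|M i j|.

Lemma sumnorm_ge0 m n (M : 'M[K]_(m, n)) : 0 <= sumnorm M.
Proof. by do 2 (apply: sumr_ge0 => ? _). Qed.

Lemma sumnorm_entry m n (M : 'M[K]_(m, n)) i j : `|M i j| <= sumnorm M.
Proof.
rewrite /sumnorm (bigD1 i) //= (bigD1 j) //= -addrA lerDl addr_ge0 //.
  exact: sumr_ge0.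
by do 2 (apply: sumr_ge0 => ? _).
Qed.

Lemma sumnorm_mul m n p (M : 'M[K]_(m, n)) (N : 'M[K]_(n, p)) :
  sumnorm (M *m N) <= sumnorm M * sumnorm N.
Proof.
rewrite mulr_suml; apply: ler_sum => i _; rewrite mulr_suml.
apply: (@le_trans _ _ (\sum_j \sum_k `|M i k| * `|N k j|)).
  apply: ler_sum => j _; rewrite mxE; apply: le_trans (ler_norm_sum _ _ _) _.
  by apply: ler_sum => k _; rewrite normrM.
rewrite exchange_big; apply: ler_sum => k _ /=.
rewrite -mulr_sumr ler_wpM2l // /sumnorm (bigD1 k) //= lerDl.
by do 2 (apply: sumr_ge0 => ? _).
Qed.

(** The factor [M] is kept because the norm of the identity matrix is its size,
    so that the norm of [X ^+ 0] is in general not bounded by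
    [sumnorm X ^+ 0]. *)
Lemma sumnorm_mulX n (M X : 'M[K]_n.+1) k :
  sumnorm (M * X ^+ k) <= sumnorm M * sumnorm X ^+ k.
Proof.
elim: k => [|k IH]; first by rewrite !expr0 !mulr1.
rewrite !exprSr !mulrA; apply: le_trans (sumnorm_mul _ _) _.
by rewrite ler_wpM2r ?sumnorm_ge0.
Qed.
End Norm.

Section Expm.
Variables (R : realType) (n : nat).
Local Notation C := (Cplx R).
Local Notation M := 'M[C]_n.+1.
Implicit Types X Y B : M.

Lemma exp_sum_real (x : R) : exp_sum (x : R^o) = series (exp_coeff x).
Proof. by apply/funext => N; apply: eq_bigr => k _; rewrite [RHS]mulrC. Qed.

(** This double sum is the defect in [exp_sum_mul] for the real numbers [a] and
    [b], and [expR] is multiplicative. *)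
Lemma cvg_exp_sum_defect (a b : R) :
  \sum_(0 <= j < N) \sum_(0 <= i < N | (N <= i + j)%N)
     (i`!%:R^-1 * j`!%:R^-1) * (a ^+ i * b ^+ j) @[N --> \oo] --> 0.
Proof.
rewrite (_ : (fun N => _) = (fun N => series (exp_coeff a) N *
   series (exp_coeff b) N - series (exp_coeff (a + b)) N)); last first.
  apply/funext => N; rewrite -!exp_sum_real.
  rewrite [X in X - _](@exp_sum_mul _ R^o); last exact: mulrC.
  by rewrite addrAC subrr add0r.
rewrite [X in _ --> X](_ : 0 = expR a * expR b - expR (a + b)); last first.
  by rewrite expRD subrr.
by apply: cvgB; [apply: cvgM|]; exact: is_cvg_series_exp_coeff.
Qed.

Lemma invf_fact_toC k : (k`!%:R^-1 : C) = toC k`!%:R^-1.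
Proof. by rewrite fmorphV rmorph_nat. Qed.

Lemma cvg_expm X : exp_sum X @ \oo --> expm R n.+1 X.
Proof.
suff : cvgn (exp_sum X) by [].
have [a a0 Xa] := ge0_toC (sumnorm_ge0 X).
have [b b0 Ib] := ge0_toC (sumnorm_ge0 (1 : M)).
apply/cvg_ex => /=.
have H i j : cvgn (series (fun k => (k`!%:R^-1 *: X ^+ k) i j)).
  apply: (@cvg_series_dominated _ _ (fun k => b * exp_coeff a k)) => [k|].
    rewrite mxE normrM mulrC [X in _ <= toC (b * X)]/= mulrA rmorphM rmorphM.
    rewrite normfV normr_nat invf_fact_toC ler_wpM2r ?ler0c ?invr_ge0 //.
    apply: le_trans (sumnorm_entry _ _ _) _.
    by rewrite -[X ^+ k]mul1r rmorphXn /= -Xa -Ib sumnorm_mulX.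
  rewrite (_ : series _ = (fun N => b * series (exp_coeff a) N)).
    by apply: is_cvgMr; exact: is_cvg_series_exp_coeff.
  by apply/funext => N; rewrite /series /= mulr_sumr.
exists (\matrix_(i, j) limn (series (fun k => (k`!%:R^-1 *: X ^+ k) i j))).
apply: cvg_mx => i j; rewrite mxE; under eq_fun do rewrite summxE.
exact: H.
Qed.

Lemma expm_limE X (L : M) : exp_sum X @ \oo --> L -> expm R n.+1 X = L.
Proof.
exact: (@cvg_unique M (@norm_hausdorff C M) (exp_sum X @ \oo) _ _ _ (@cvg_expm X)).
Qed.

(** By [exp_sum_mul] the two sides differ by the limit of a double sum whose
    entries are bounded by the real double sum of [cvg_exp_sum_defect], taken at
    the norms of [X] and [Y]. *)
Lemma expmD X Y : GRing.comm X Y ->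
  expm R n.+1 (X + Y) = expm R n.+1 X * expm R n.+1 Y.
Proof.
move=> cXY; apply: expm_limE.
have -> : exp_sum (X + Y) = (fun N => exp_sum X N *m exp_sum Y N) \-
                         (fun N => exp_sum X N * exp_sum Y N - exp_sum (X + Y) N).
  by apply/funext => N /=; rewrite opprB addrCA subrr addr0.
rewrite -[X in _ --> X]subr0; apply: cvgB.
  by apply: cvg_mulmx; exact: cvg_expm.
have [a a0 Xa] := ge0_toC (sumnorm_ge0 X).
have [b b0 Yb] := ge0_toC (sumnorm_ge0 Y).
have [c c0 Ic] := ge0_toC (sumnorm_ge0 (1 : M)).
apply: cvg_mx => p q; rewrite mxE.
apply: (@cvg_dominated0 _ _ (fun N => c *
  \sum_(0 <= j < N) \sum_(0 <= i < N | (N <= i + j)%N)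
     (i`!%:R^-1 * j`!%:R^-1) * (a ^+ i * b ^+ j))); last first.
  rewrite -[X in _ --> X](mulr0 c); apply: cvgMr; exact: cvg_exp_sum_defect.
move=> N; rewrite exp_sum_mul // addrAC subrr add0r summxE mulr_sumr rmorph_sum.
apply: le_trans (ler_norm_sum _ _ _) _; apply: ler_sum => j _.
rewrite summxE mulr_sumr rmorph_sum.
apply: le_trans (ler_norm_sum _ _ _) _; apply: ler_sum => i _.
rewrite mxE normrM !rmorphM /= -!invf_fact_toC mulrCA ger0_norm ?mulr_ge0 ?invr_ge0 //.
rewrite ler_wpM2l ?mulr_ge0 ?invr_ge0 //.
apply: le_trans (sumnorm_entry _ _ _) _.
rewrite -[X ^+ i]mul1r !rmorphXn /= -Xa -Yb -Ic mulrA.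
apply: le_trans (sumnorm_mulX _ _ _) _; rewrite ler_wpM2r ?exprn_ge0 ?sumnorm_ge0 //.
exact: sumnorm_mulX.
Qed.

(** Identities between partial sums pass to the limit through sequentially
    continuous maps. *)
Lemma expm_transfer p q (f g : M -> 'M[C]_(p, q)) X Y :
  (forall (u : nat -> M) (l : M), u @ \oo --> l -> f (u k) @[k --> \oo] --> f l) ->
  (forall (u : nat -> M) (l : M), u @ \oo --> l -> g (u k) @[k --> \oo] --> g l) ->
  (forall N, f (exp_sum X N) = g (exp_sum Y N)) ->
  f (expm R n.+1 X) = g (expm R n.+1 Y).
Proof.
move=> fc gc fg.
apply: (@cvg_unique _ (@norm_hausdorff C 'M[C]_(p, q)) (f (exp_sum X k) @[k --> \oo])).
  exact: fc (@cvg_expm X).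
rewrite (_ : (fun k => f (exp_sum X k)) = (fun k => g (exp_sum Y k))); last first.
  exact/funext.
exact: gc (@cvg_expm Y).
Qed.

Lemma comm_expm B X : GRing.comm B X -> GRing.comm B (expm R n.+1 X).
Proof.
move=> cBX; apply: (@expm_transfer _ _ (fun Z => B *m Z) (fun Z => Z *m B)).
- by move=> u l ul; apply: cvg_mulmx ul; exact: cvg_cst.
- by move=> u l ul; apply: cvg_mulmx; [exact: ul|exact: cvg_cst].
- move=> N; apply: commr_sum => k _; rewrite /GRing.comm -scalerAl -scalerAr.
  by congr (_ *: _); exact: commrX.
Qed.

(** Complex numbers are exponentiated as scalar matrices, so that a single
    exponential serves for matrices and for their eigenvalues. *)
Lemma eigen_expm p (v : 'M[C]_(p, n.+1)) X (mu : C) :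
  v *m X = mu *: v -> v *m expm R n.+1 X = v *m expm R n.+1 mu%:M.
Proof.
move=> vX; have c u (l : M) : u @ \oo --> l -> v *m u k @[k --> \oo] --> v *m l.
  by move=> ul; apply: cvg_mulmx ul; exact: cvg_cst.
apply: (@expm_transfer p n.+1 (mulmx v) (mulmx v) X mu%:M c c) => N.
exact: eigen_exp_sum.
Qed.

Lemma expm_scalar_mx (c l : C) : exp_sum (c : C^o) @ \oo --> l ->
  expm R n.+1 c%:M = l%:M.
Proof.
move=> cl; apply: expm_limE; apply: cvg_mx => i j; rewrite mxE.
rewrite (_ : (fun k => _) = (fun k => exp_sum (c : C^o) k *+ (i == j))).
  by apply: cvgMn.
apply/funext => N; rewrite summxE -sumrMnl; apply: eq_bigr => k _.
by rewrite mxE -(rmorphXn (@scalar_mx _ n.+1)) mxE mulrnAr.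
Qed.

Lemma expm_real (r : R) : expm R n.+1 (toC r)%:M = (toC (expR r))%:M.
Proof.
apply: expm_scalar_mx.
rewrite (_ : exp_sum _ = fun N => toC (series (exp_coeff r) N)).
  by apply: cvg_toC; exact: is_cvg_series_exp_coeff.
apply/funext => N; rewrite rmorph_sum; apply: eq_bigr => k _.
by rewrite [LHS](mulrC (k`!%:R^-1 : C)) [RHS]rmorphM rmorphXn invf_fact_toC.
Qed.

(** Euler's formula holds for the partial sums: the coefficients of the real
    cosine and sine series pick out the even and the odd powers of ['i]. *)
Lemma expm_imag (r : R) :
  expm R n.+1 (toC r * 'i)%:M = (toC (cos r) + toC (sin r) * 'i)%:M.
Proof.
apply: expm_scalar_mx.
rewrite (_ : exp_sum _ = (fun N => toC (series (cos_coeff r) N) +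
                                toC (series (sin_coeff r) N) * 'i)).
  rewrite cos.unlock sin.unlock; apply: cvgD; [|apply: cvgMl]; apply: cvg_toC.
    exact: is_cvg_series_cos_coeff.
  exact: is_cvg_series_sin_coeff.
apply/funext => N; rewrite !rmorph_sum mulr_suml -big_split; apply: eq_bigr => k _ /=.
have -> : (toC r * 'i) ^+ k = toC (r ^+ k) *
    ((~~ odd k)%:R * (-1) ^+ k./2 + (odd k)%:R * (-1) ^+ k.-1./2 * 'i).
  rewrite exprMn -rmorphXn /=; congr (_ * _).
  move: (odd k) (k./2) (odd_double_half k) => b m <-.
  case: b => /=; rewrite !mul0r mul1r.
    by rewrite add0r add1n /= doubleK exprS -muln2 mulnC exprM sqrCi mulrC.
  by rewrite addr0 add0n -muln2 mulnC exprM sqrCi.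
rewrite [LHS](mulrC (k`!%:R^-1 : C)) invf_fact_toC /cos_coeff /sin_coeff /=.
rewrite !rmorphM !rmorphXn !rmorph_nat rmorphN1 /=.
ring.
Qed.

Lemma expm0 : expm R n.+1 0 = 1.
Proof.
by have := expm_real (0 : R); rewrite rmorph0 expR0 rmorph1.
Qed.

Lemma expmNr X : expm R n.+1 X * expm R n.+1 (- X) = 1.
Proof.
rewrite -expmD ?subrr ?expm0 //.
exact/commrN/commr_refl.
Qed.

End Expm.

(** * Nilpotent and unipotent matrices *)

Section Nilpotent.
Variables (R : realType) (n : nat).
Local Notation C := (Cplx R).
Local Notation M := 'M[C]_n.+1.
Implicit Types X Y B : M.

Lemma expm_nilpotent X m : X ^+ m = 0 -> expm R n.+1 X = exp_sum X m.
Proof.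
move=> Xm; apply: expm_limE; apply: cvg_near_cst; near=> N.
have mN : (m <= N)%N by near: N; exact: nbhs_infty_ge.
rewrite /exp_sum (big_cat_nat _ mN) //= -[RHS]addr0; congr (_ + _).
rewrite big_nat big1 // => k /andP[mk _].
by rewrite -(subnKC mk) exprD Xm mul0r scaler0.
Unshelve. all: by end_near. Qed.

(** The bicommutant of [A] stands in for the algebra of polynomials in [A]:
    it is stable under [expm] by [comm_expm], with no need to exhibit a
    polynomial. *)
Definition bicomm A X := forall B, GRing.comm B A -> GRing.comm B X.

Lemma expm_nilpotent2 X m : X ^+ m = 0 -> exists2 G, bicomm X G &
  expm R n.+1 X = 1 + X + X ^+ 2 * G.
Proof.
move=> Xm; exists (\sum_(0 <= k < m) (k.+2)`!%:R^-1 *: X ^+ k).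
  move=> B cBX; apply: commr_sum => k _.
  rewrite /GRing.comm -scalerAl -scalerAr; congr (_ *: _); exact: commrX.
rewrite (@expm_nilpotent _ m.+2); last by rewrite !exprS Xm !mulr0.
rewrite /exp_sum !big_nat_recl // !fact0 invr1 !scale1r expr0 expr1 addrA.
rewrite mulr_sumr; congr (_ + _); apply: eq_bigr => k _.
by rewrite -scalerAr -exprD.
Qed.

Lemma nilpotentD X Y : GRing.comm X Y -> (exists m, X ^+ m = 0) ->
  (exists m, Y ^+ m = 0) -> exists m, (X + Y) ^+ m = 0.
Proof.
move=> cXY [a Xa] [b Yb]; exists (a + b)%N; rewrite exprDn_comm // big1 // => i _.
have [bi|ib] := leqP b i.
  by rewrite -(subnKC bi) (exprD Y) Yb mul0r mulr0 mul0rn.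
have le : (a <= a + b - i)%N by rewrite -addnBA ?leq_addr // ltnW.
by rewrite -(subnKC le) (exprD X) Xa !mul0r mul0rn.
Qed.

(** Since exp X = 1 + X + X^2 G, the hypothesis gives X = X^2 (-G); feeding this
    equation into itself makes X a multiple of every power of X. *)
Lemma nilpotent_expm_eq1 X m : X ^+ m = 0 -> expm R n.+1 X = 1 -> X = 0.
Proof.
move=> Xm; have [G cG ->] := expm_nilpotent2 Xm.
move=> H; have XG : X = - (X ^+ 2 * G).
  apply/eqP; rewrite -addr_eq0; apply/eqP; apply: (addrI 1).
  by rewrite addrA H addr0.
suff XE k : X = X ^+ k.+1 * (- G) ^+ k.
  by rewrite (XE m) exprS Xm mulr0 mul0r.
elim: k => [|k IH]; first by rewrite mulr1.
have XS : X ^+ k.+1 = X ^+ k.+2 * - G.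
  by rewrite exprSr {2}XG -mulrN mulrA -exprD addn2.
by rewrite {1}IH XS -mulrA -exprS.
Qed.

(** A Newton iteration replaces the power series of log(1 + X): the matrix
    (1 + X) exp(-X) is 1 + Y with Y a multiple of X^2, so Y has a smaller
    nilpotency index, and if exp Z = 1 + Y then exp(X + Z) = 1 + X. *)
Lemma unipotent_log X m : X ^+ m = 0 -> exists Z,
  [/\ expm R n.+1 Z = 1 + X, exists k, Z ^+ k = 0 & bicomm X Z].
Proof.
elim: m X => [|m IH] X.
  move=> H; have X0 : X = 0 by rewrite -[X]mulr1 -(expr0 X) H mulr0.
  exists 0; split; first by rewrite X0 expm0 addr0.
    by exists 1%N; rewrite expr1.
  by move=> B _; exact: commr0.
case: m IH => [_|m IH] Xm.
  exists 0; split; first by rewrite -[X]expr1 Xm expm0 addr0.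
    by exists 1%N; rewrite expr1.
  by move=> B _; exact: commr0.
have NXm : (- X) ^+ m.+2 = 0 by rewrite exprNn Xm mulr0.
have [G cG EG] := expm_nilpotent2 NXm.
pose Y := (1 + X) * expm R n.+1 (- X) - 1.
have cXG : GRing.comm X G by apply: cG; exact/commrN/commr_refl.
have YE : Y = X ^+ 2 * (G + X * G - 1).
  have XX : (1 + X) * (1 - X) = 1 - X ^+ 2.
    by rewrite mulrDl mul1r mulrBr mulr1 addrA subrK.
  rewrite /Y EG sqrrN mulrDr XX addrAC (addrC 1) addrK addrC mulrDl mul1r.
  by rewrite mulrBr mulr1 mulrDr !expr2 !mulrA.
have cY B : GRing.comm B X -> GRing.comm B Y.
  move=> cBX; apply: commrB; last exact: commr1.
  apply: commrM; first by apply: commrD => //; exact: commr1.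
  exact/comm_expm/commrN.
have [|Z [EZ [k Zk] cZ]] := IH Y.
  rewrite YE exprMn_comm; last first.
    apply: commr_sym; apply: commrX; apply: commr_sym.
    apply: commrB; last exact: commr1.
    by apply: commrD => //; apply: commrM => //; exact: commr_refl.
  (* A multiple of X^2 to the power m.+1 is a multiple of X^(2 m + 2), which
     vanishes: the induction needs m.+1 < m.+2 <= 2 (m + 1). *)
  rewrite -exprM (_ : (2 * m.+1 = m.+2 + m)%N); last first.
    by rewrite mul2n -addnn addSnnS addnC.
  by rewrite exprD Xm !mul0r.
have cXZ : GRing.comm X Z by apply/cZ/cY/commr_refl.
exists (X + Z); split.
- rewrite expmD // EZ /Y addrC subrK.
  rewrite mulrA -(comm_expm (B := 1 + X)); last first.
    by apply: commr_sym; apply: commrD; [exact: commr1|exact: commr_refl].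
  by rewrite -mulrA expmNr mulr1.
- apply: nilpotentD => //; [by exists m.+2|by exists k].
- by move=> B cBX; apply: commrD => //; exact/cZ/cY.
Qed.
End Nilpotent.

(** * Common eigenvectors and interpolation *)

Section Eigen.
Variables (K : numClosedFieldType) (n : nat).
Local Notation M := 'M[K]_n.+1.

(** The characteristic polynomial is then a power of ['X]; Cayley-Hamilton. *)
Lemma nilpotent_eigenvalue (X : M) :
  (forall a, eigenvalue X a -> a = 0) -> exists m, X ^+ m = 0.
Proof.
move=> X0; have [r] := closed_field_poly_normal (char_poly X).
rewrite (monicP (char_poly_monic X)) scale1r => rE.
exists (size r).
have r0 : {in r, forall z, 'X - z%:P = 'X :> {poly K}}.
  move=> z zr; rewrite (X0 z) ?subr0 //.
  by rewrite eigenvalue_root_char rE root_prod_XsubC.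
have := Cayley_Hamilton X; rewrite rE (eq_big_seq _ r0) big_const_seq count_predT.
by rewrite iter_mulr_1 rmorphXn /= horner_mx_X.
Qed.

(** It is enough to test the eigenvalues of [X] on common eigenvectors with a
    commuting [A]: each eigenspace of [X] is stable under [A] and therefore
    contains an eigenvector of [A]. *)
Lemma nilpotent_common_eigenvector (A X : M) : GRing.comm X A ->
  (forall (v : 'rV_n.+1) a b, v != 0 -> v *m A = a *: v -> v *m X = b *: v -> b = 0) ->
  exists m, X ^+ m = 0.
Proof.
move=> cXA H; apply: nilpotent_eigenvalue => b Xb.
have Est : stablemx (eigenspace X b) A by apply: comm_mx_stable_eigenspace.
have [|a] := @eigenvalue_closed K _ (restrictmx (eigenspace X b) A).
  by rewrite lt0n mxrank_eq0.
case/eigenvalueP => w wA w0.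
pose v := w *m row_base (eigenspace X b).
have v0 : v != 0 by rewrite mulmx_free_eq0 ?row_base_free.
have vX : v *m X = b *: v.
  by apply/eigenspaceP; rewrite mulmx_sub // eq_row_base.
have : stablemx v A.
  by rewrite -stablemx_restrict // wA scalemx_sub.
by case/eigenvectorP => c /eigenspaceP vA; exact: (H v c b).
Qed.

Lemma eigen_horner p (v : 'M[K]_(p, n.+1)) (A : M) a (P : {poly K}) :
  v *m A = a *: v -> v *m horner_mx A P = P.[a] *: v.
Proof.
move=> vA; elim/poly_ind: P => [|P c IH].
  by rewrite rmorph0 mulmx0 horner0 scale0r.
rewrite rmorphD rmorphM /= horner_mx_X horner_mx_C mulmxDr mulmxA IH.
by rewrite -scalemxAl vA scalerA mul_mx_scalar hornerMXaddC scalerDl.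
Qed.

Lemma eigen_scalar_inj (v : 'rV[K]_n.+1) a b : v != 0 -> a *: v = b *: v -> a = b.
Proof.
move=> v0 /eqP; rewrite -subr_eq0 -scalerBl scaler_eq0 (negPf v0) orbF subr_eq0.
by move/eqP.
Qed.

Lemma eigenD p (v : 'M[K]_(p, n.+1)) (X Y : M) a b :
  v *m X = a *: v -> v *m Y = b *: v -> v *m (X + Y) = (a + b) *: v.
Proof. by move=> vX vY; rewrite mulmxDr vX vY scalerDl. Qed.

Lemma eigen_neq0 (v : 'rV[K]_n.+1) (A : M) a :
  A \in unitmx -> v != 0 -> v *m A = a *: v -> a != 0.
Proof.
move=> Au v0 vA; apply: contraNneq v0 => a0.
by rewrite -(mulmxK Au v) vA a0 scale0r mul0mx.
Qed.

Lemma eigenV p (v : 'M[K]_(p, n.+1)) (A B : M) a :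
  a != 0 -> A * B = 1 -> v *m A = a *: v -> v *m B = a^-1 *: v.
Proof.
move=> a0 AB vA; apply: (scalerI a0).
by rewrite scalerA divff // scale1r scalemxAl -vA -mulmxA mulmxE AB mulmx1.
Qed.

Lemma eigen_unipotent (v : 'rV[K]_n.+1) (A E : M) a b : a != 0 -> v != 0 ->
  v *m A = a *: v -> v *m E = a^-1 *: v -> v *m (E * A - 1) = b *: v -> b = 0.
Proof.
move=> a0 v0 vA vE H; apply: (eigen_scalar_inj v0); rewrite -H.
rewrite mulmxBr mulmxA vE -scalemxAl vA scalerA mulVf // scale1r mulmx1.
by rewrite scale0r subrr.
Qed.
End Eigen.

Lemma unitmx_mulr1 (K : fieldType) n (A B : 'M[K]_n.+1) : A * B = 1 -> A \in unitmx.
Proof. by case/mulmx1_unit. Qed.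

Lemma commr_inverse (S : pzRingType) (x y z : S) :
  x * y = 1 -> y * x = 1 -> GRing.comm z y -> GRing.comm z x.
Proof.
move=> xy yx zy; rewrite /GRing.comm -[LHS]mul1r -xy -mulrA (mulrA y) -zy.
by rewrite -!mulrA yx mulr1.
Qed.

Lemma conj_invK (K : numClosedFieldType) (a : K) : ((a^*)^-1)^* = a^-1.
Proof. by rewrite -fmorphV conjCK. Qed.

Lemma conj_oppK (K : numClosedFieldType) (a : K) : (- a^*)^* = - a.
Proof. by rewrite raddfN /= conjCK. Qed.

Lemma interpolation (F : fieldType) (f : F -> F) (s : seq F) :
  exists p : {poly F}, {in s, forall x, p.[x] = f x}.
Proof.
elim: s => [|a s [p pf]]; first by exists 0.
have [as_|as_] := boolP (a \in s).
  by exists p => x; rewrite inE => /predU1P[->|]; exact: pf.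
pose q := \prod_(z <- s) ('X - z%:P).
have qa : q.[a] != 0 by rewrite -/(root q a) root_prod_XsubC.
exists (p + ((f a - p.[a]) / q.[a]) *: q) => x; rewrite inE !hornerE.
case/predU1P => [->|xs]; first by rewrite divfK // addrC subrK.
have /rootP -> : root q x by rewrite root_prod_XsubC.
by rewrite mulr0 addr0 pf.
Qed.

(** * The adjoint with respect to a form *)

Section Adj.
Variables (K : numClosedFieldType) (n : nat) (J : 'M[K]_n.+1).
Local Notation M := 'M[K]_n.+1.
Hypothesis Ju : J \in unitmx.
Implicit Types X Y : M.

(** The adjoint of [X] for the sesquilinear form with matrix [J]. *)
Definition formadj X : M := invmx J *m X^t* *m J.

Lemma formadjD X Y : formadj (X + Y) = formadj X + formadj Y.
Proof. by rewrite /formadj linearD /= map_mxD mulmxDr mulmxDl. Qed.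

Lemma formadj0 : formadj 0 = 0.
Proof. by rewrite /formadj trmx0 map_mx0 mulmx0 mul0mx. Qed.

Lemma formadjZ a X : formadj (a *: X) = a^* *: formadj X.
Proof. by rewrite /formadj linearZ /= map_mxZ -scalemxAr -scalemxAl. Qed.

Lemma formadjM X Y : formadj (X * Y) = formadj Y * formadj X.
Proof. by rewrite /formadj trmx_mul map_mxM /= -!mulmxE !mulmxA mulmxK. Qed.

Lemma formadj1 : formadj 1 = 1.
Proof. by rewrite /formadj trmx1 map_mx1 mulmx1 mulVmx. Qed.

Lemma formadjX X k : formadj (X ^+ k) = formadj X ^+ k.
Proof.
elim: k => [|k IH]; first by rewrite formadj1.
by rewrite exprS formadjM IH exprSr.
Qed.

Lemma formadj_comm X Y : GRing.comm X Y -> GRing.comm (formadj X) (formadj Y).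
Proof. by move=> cXY; rewrite /GRing.comm -!formadjM cXY. Qed.

Lemma formadj_exp_sum X N : formadj (exp_sum X N) = exp_sum (formadj X) N.
Proof.
rewrite /exp_sum (big_morph formadj formadjD formadj0); apply: eq_bigr => k _.
by rewrite formadjZ formadjX fmorphV rmorph_nat.
Qed.

Lemma formadj_horner X (P : {poly K}) :
  formadj (horner_mx X P) = horner_mx (formadj X) (map_poly (@Num.conj K) P).
Proof.
elim/poly_ind: P => [|P c IH]; first by rewrite !rmorph0 formadj0.
rewrite !rmorphD !rmorphM /= map_polyX map_polyC /= !horner_mx_X !horner_mx_C.
rewrite formadjD formadjM IH -scalemx1 formadjZ formadj1 scalemx1.
congr (_ + _); exact: (comm_mx_horner _ (erefl _)).
Qed.

Lemma formadj_skewP X : X^t* *m J + J *m X = 0 <-> formadj X = - X.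
Proof.
split=> [/eqP|H].
  by rewrite addr_eq0 => /eqP H; rewrite /formadj -mulmxA H mulmxN mulKmx.
apply/eqP; rewrite addr_eq0 -(mulKVmx Ju (X^t* *m J)) -mulmxN -H.
by rewrite /formadj !mulmxA.
Qed.

Lemma formadj_isometryP X : X^t* *m J *m X = J <-> formadj X * X = 1.
Proof.
have E : formadj X * X = invmx J *m (X^t* *m J *m X).
  by rewrite /formadj -mulmxE !mulmxA.
split=> H; first by rewrite E H mulVmx.
by rewrite -(mulKVmx Ju (X^t* *m J *m X)) -E H mulmx1.
Qed.
End Adj.

Section ExpmAdj.
Variable R : realType.
Local Notation C := (Cplx R).

Lemma expm_formadj n (J X : 'M[C]_n.+1) : J \in unitmx ->
  expm R n.+1 (formadj J X) = formadj J (expm R n.+1 X).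
Proof.
move=> Ju; symmetry.
apply: (@expm_transfer _ _ _ _ (formadj J) id) => [u l ul|//|N].
  apply: cvg_mulmx; last exact: cvg_cst.
  by apply: cvg_mulmx; [exact: cvg_cst|exact: cvg_adjoint].
exact: (formadj_exp_sum Ju).
Qed.

Lemma expm_isometry n (J X : 'M[C]_n.+1) : J \in unitmx ->
  X^t* *m J + J *m X = 0 ->
  expm R n.+1 X \in unitmx /\ (expm R n.+1 X)^t* *m J *m expm R n.+1 X = J.
Proof.
move=> Ju /(formadj_skewP Ju) H; split; first exact: unitmx_mulr1 (expmNr X).
apply/(formadj_isometryP Ju); rewrite -expm_formadj // H.
by rewrite -{2}[X]opprK expmNr.
Qed.
End ExpmAdj.

(** * A symmetric branch of the complex logarithm *)

Section ComplexLog.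
Variable R : realType.
Local Notation C := (Cplx R).

Lemma unit_circle_angle (u : C) : `|u| = 1 ->
  exists t : R, toC (cos t) + toC (sin t) * 'i = u.
Proof.
case: u => x y; rewrite normc_def => -[/= H].
have xy : x ^+ 2 + y ^+ 2 = 1.
  by rewrite -[LHS]sqr_sqrtr ?H ?expr1n // addr_ge0 // sqr_ge0.
have x1 : -1 <= x <= 1.
  rewrite -ler_norml -(@expr_le1 _ 2) // real_normK ?num_real //.
  by rewrite -xy lerDl sqr_ge0.
have c : cos (acos x) = x by rewrite acosK.
have s : sin (acos x) = `|y| by rewrite sin_acos // -xy addrC addKr sqrtr_sqr.
have e (a b : R) : toC a + toC b * 'i = (a +i* b)%C :> C.
  by rewrite mulrC -complexiE; exact: esym (complexE (a +i* b)%C).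
have [y0|y0] := lerP 0 y.
  by exists (acos x); rewrite e c s ger0_norm.
by exists (- acos x); rewrite e cosN sinN c s ltr0_norm // opprK.
Qed.

(** Log z = ln|z| + i arg(z/|z|) for any choice of the argument on the unit
    circle. The two numbers z and 1/conj(z) have the same direction and inverse
    moduli, which gives the second property. *)
Lemma complex_log : exists Log : C -> C,
  (forall n z, z != 0 -> expm R n.+1 (Log z)%:M = z%:M) /\
  (forall z, z != 0 -> Log (z^*)^-1 = - (Log z)^*).
Proof.
have [arg argP] : exists arg : C -> R, forall u, `|u| = 1 ->
    toC (cos (arg u)) + toC (sin (arg u)) * 'i = u.
  have /choice[arg H] : forall u : C, exists t : R, `|u| = 1 ->
      toC (cos t) + toC (sin t) * 'i = u.
    move=> u; have [/unit_circle_angle[t tu]|n] := pselect (`|u| = 1).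
      by exists t.
    by exists 0.
  by exists arg.
pose nrm (z : C) := complex.Re `|z|.
have nrmE z : `|z| = toC (nrm z) by rewrite /nrm normc_def.
have nrm_gt0 z : z != 0 -> 0 < nrm z by rewrite -normr_gt0 nrmE ltcR.
exists (fun z => toC (ln (nrm z)) + toC (arg (z / `|z|)) * 'i); split=> [n z z0|z z0].
  rewrite (raddfD (@scalar_mx C n.+1)) expmD; last exact: comm_scalar_mx.
  rewrite expm_real expm_imag lnK ?posrE ?nrm_gt0 // argP; last first.
    by rewrite normrM normfV normr_id divff // normr_eq0.
  by rewrite -(rmorphM (@scalar_mx C n.+1)) -nrmE mulrC divfK // normr_eq0.
have nn0 : `|z| != 0 by rewrite normr_eq0.
have zz : (z^*)^-1 = z / `|z| ^+ 2.
  by rewrite normCK invfM mulrA divff // mul1r.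
have nV : nrm (z^*)^-1 = (nrm z)^-1.
  apply: (@complexI R); rewrite -!/(toC _) -nrmE normfV norm_conjC nrmE.
  by rewrite fmorphV.
have -> : (z^*)^-1 / `|(z^*)^-1| = z / `|z|.
  by rewrite normfV norm_conjC invrK zz expr2 invfM mulrA divfK.
rewrite nV lnV ?posrE ?nrm_gt0 //.
have -> : toC (- ln (nrm z)) = - toC (ln (nrm z)) by rewrite rmorphN.
have cR (r : R) : (toC r)^* = toC r.
  by apply: conj_Creal; apply/complex_realP; exists r.
by rewrite rmorphD rmorphM /= !cR conjCi opprD mulrN opprK.
Qed.

End ComplexLog.

(** * Logarithms of matrices and of isometries *)

Section Logarithm.
Variables (R : realType) (n : nat).
Local Notation C := (Cplx R).
Local Notation M := 'M[C]_n.+1.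
Local Notation exp := (expm R n.+1).
Implicit Types A B X Z : M.

Lemma bicomm_horner A (P : {poly C}) : bicomm A (horner_mx A P).
Proof. by move=> B cBA; apply: comm_mx_horner. Qed.

Lemma eigen_expm_log p (v : 'M[C]_(p, n.+1)) X (l a : C) : a != 0 ->
  exp l%:M = a%:M -> v *m X = l *: v -> v *m exp (- X) = a^-1 *: v.
Proof.
move=> a0 la vX.
have vNX : v *m (- X) = - l *: v by rewrite mulmxN vX scaleNr.
rewrite (eigen_expm vNX) -mul_mx_scalar; congr (_ *m _).
have -> : (- l)%:M = - l%:M :> M by rewrite raddfN.
have aV : (a^-1)%:M * a%:M = 1 :> M.
  by rewrite -(rmorphM (@scalar_mx C n.+1)) mulVf // rmorph1.
by rewrite -[LHS]mul1r -aV -mulrA -la expmNr mulr1.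
Qed.

(** On a common eigenvector the matrix exp(-P(A)) A - 1 acts as
    a^-1 a - 1 = 0, so it is nilpotent, and the logarithm of its unipotent
    translate corrects [horner_mx A P]. *)
Lemma log_of_branch A (P : {poly C}) : A \in unitmx ->
  (forall a, eigenvalue A a -> exp (P.[a])%:M = a%:M) ->
  exists Z, [/\ exp (horner_mx A P + Z) = A, exists m, Z ^+ m = 0 & bicomm A Z].
Proof.
move=> Au PA; set X := horner_mx A P.
have cX : bicomm A X := @bicomm_horner A P.
pose N := exp (- X) * A - 1.
have cN : bicomm A N.
  move=> B cBA; apply: commrB; last exact: commr1.
  by apply: commrM => //; apply/comm_expm/commrN/cX.
have [m Nm] : exists m, N ^+ m = 0.
  apply: (@nilpotent_common_eigenvector _ _ A); first exact/commr_sym/cN/commr_refl.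
  move=> v a b v0 vA vN.
  have a0 := eigen_neq0 Au v0 vA.
  have Aa : eigenvalue A a by apply/eigenvalueP; exists v.
  apply: (eigen_unipotent a0 v0 vA _ vN).
  exact: (eigen_expm_log a0 (PA a Aa) (eigen_horner P vA)).
have [Z [EZ Znil cZ]] := unipotent_log Nm.
exists Z; split=> //; last by move=> B cBA; exact/cZ/cN.
rewrite expmD; last by apply/cZ/cN/commr_sym/cX/commr_refl.
by rewrite EZ addrC subrK mulrA expmNr mul1r.
Qed.

(** The logarithm of [A] built from a branch with the symmetry of
    [complex_log] is skew for the form, because the sum of this logarithm and
    its adjoint is nilpotent and has exponential 1. *)
Lemma isometry_expm (J A : M) : J \in unitmx -> A^t* *m J *m A = J ->
  exists2 X, X^t* *m J + J *m X = 0 & exp X = A.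
Proof.
move=> Ju /(formadj_isometryP Ju) BA.
set B := formadj J A in BA.
have AB : A * B = 1 by exact: mulmx1C BA.
have Au : A \in unitmx := unitmx_mulr1 AB.
have [Log [expLog LogV]] := complex_log R.
have [s sP] : exists s : seq C, forall a, eigenvalue A a -> a \in s.
  have [s sE] := closed_field_poly_normal (char_poly A).
  exists s => a; rewrite eigenvalue_root_char sE rootZ ?root_prod_XsubC //.
  by rewrite lead_coef_eq0 monic_neq0 // char_poly_monic.
(* The points 1/conj(a) enter because the adjoint of P(A) is conj(P)(A^-1). *)
have [P PLog] := interpolation Log (s ++ [seq (z^*)^-1 | z <- s]).
have [|Z [EA Znil cZ]] := @log_of_branch A P Au.
  move=> a Aa; rewrite PLog ?mem_cat ?sP // expLog //.
  by case/eigenvalueP: Aa => v vA v0; exact: (eigen_neq0 Au v0 vA).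
set X0 := horner_mx A P in EA.
have cX0 : bicomm A X0 := @bicomm_horner A P.
pose X := X0 + Z; exists X => //.
have dagD : formadj J X = formadj J X0 + formadj J Z by exact: formadjD.
have cAdag U : bicomm A U -> GRing.comm (formadj J U) A.
  move=> cU; have : GRing.comm (formadj J U) B.
    by apply: formadj_comm => //; apply/commr_sym/cU/commr_refl.
  exact: commr_inverse AB BA.
have cdag U V : bicomm A U -> bicomm A V -> GRing.comm (formadj J U) V.
  by move=> cU cV; apply/cV/cAdag.
have dagX0 : formadj J X0 = horner_mx B (map_poly (@Num.conj C) P).
  exact: formadj_horner.
apply/(formadj_skewP Ju)/eqP; rewrite -addr_eq0; apply/eqP.
have cUA U : bicomm A U -> GRing.comm U A.
  by move=> cU; apply/commr_sym/cU/commr_refl.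
have cUV U V : bicomm A U -> bicomm A V -> GRing.comm U V.
  by move=> cU cV; exact/cV/cUA.
have cdd U V : bicomm A U -> bicomm A V ->
    GRing.comm (formadj J U) (formadj J V).
  by move=> cU cV; apply: formadj_comm => //; exact: cUV.
have [m Dm] : exists m, (formadj J X + X) ^+ m = 0.
  rewrite dagD /X addrACA; apply: nilpotentD.
  - apply: commrD; apply: commr_sym; apply: commrD;
      by [exact: cdd|exact/commr_sym/cdag|exact: cdag|exact: cUV].
  - apply: (@nilpotent_common_eigenvector _ _ A).
      by apply/commr_sym; apply: commrD; apply: commr_sym; [exact: cAdag|exact: cUA].
    move=> v a b v0 vA vD.
    have a0 := eigen_neq0 Au v0 vA.
    have as_ : a \in s by apply/sP/eigenvalueP; exists v.
    rewrite dagX0 in vD.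
    have := eigenD (eigen_horner (map_poly (@Num.conj C) P) (eigenV a0 AB vA))
                   (eigen_horner P vA).
    rewrite vD => /(eigen_scalar_inj v0) ->.
    rewrite -conj_invK horner_map !PLog; last 2 first.
    + by rewrite mem_cat as_.
    + by rewrite mem_cat; apply/orP; right; apply/mapP; exists a.
    by rewrite LogV //= conj_oppK addNr.
  - apply: nilpotentD; [exact: cdag| |by []].
    by case: Znil => k Zk; exists k; rewrite -formadjX // Zk formadj0.
apply: (nilpotent_expm_eq1 Dm).
have cX : bicomm A X by move=> U cU; apply: commrD; [exact: cX0|exact: cZ].
by rewrite expmD ?EA ?expm_formadj ?EA //; exact: cdag.
Qed.
End Logarithm.

Lemma Ipq_unit (R : realType) (p q : nat) : Ipq R p q \in unitmx.
Proof.
have : Ipq R p q *m Ipq R p q = 1%:M.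
  rewrite /Ipq mulmx_block !mul0mx !mulmx0 !mulmxN !mulNmx opprK !mulmx1.
  by rewrite !addr0 !add0r ?oppr0 -scalar_mx_block.
by case/mulmx1_unit.
Qed.

Theorem corollary4p8 (R : realType) (p q : nat) (hn : (1 <= p + q)%N) :
  set_fun (upq R p q) (Upq R p q) (expm R (p + q)%N) /\
  set_surj (upq R p q) (Upq R p q) (expm R (p + q)%N).
Proof.
rewrite /set_fun /set_surj /upq /Upq.
(* The square matrices form an algebra with 1 <> 0 only in positive size, so
   the size is put in successor form. *)
have := Ipq_unit R p q; move: (Ipq R p q); case: (p + q)%N hn => // n _ J Ju.
split=> [X|A [Au AJ]] /=; first exact: expm_isometry.
by have [X XJ EX] := isometry_expm Ju AJ; exists X.
Qed.
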